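(* Let $\alpha>0$, $\beta>0$, $t>0$. For integers $n\ge 0$ let $\widetilde H_n:=H_n-n(n+\alpha+\beta)$, where $H_n=H_n(t)=t\frac{d}{dt}\ln D_n(t)$ and $D_n(t)=\det\left(\int_0^1 x^{i+j}e^{-t/x}x^{\alpha}(1-x)^{\beta}dx\right)_{i,j=0}^{n-1}$. Then for every $n\ge 1$, $\widetilde H_n$ satisfies the non-linear second order difference equation $$\begin{aligned} & nt-\frac{(2n+\alpha)(\widetilde H_n+n(\beta+t))}{2n+\alpha+\beta}+\frac{\widetilde Z_n}{2n+\alpha+\beta}\left[-2n-\alpha-t+\frac{2(\widetilde H_n+n(\beta+t))}{2n+\alpha+\beta}\right]+\frac{2\widetilde Z_n^2}{(2n+\alpha+\beta)^2}\\ &=\frac{1}{Z_n}\Big(-2\widetilde H_n^2+2\widetilde H_n(1+\widetilde H_{n+1})+\widetilde H_{n+1}(2n-1+\alpha+\beta)-\widetilde H_{n-1}\big(2n+1+\alpha+\beta-2\widetilde H_n+2\widetilde H_{n+1}\big)\Big)\\ &\quad\times\Big(-nt(\beta+t)+\frac{(\alpha\beta+2\beta(n-t)+(2n-t)t)(\widetilde H_n+n(\beta+t))}{2n+\alpha+\beta}\\ &\qquad\quad+\frac{(-\alpha+2\beta-2n+3t)(\widetilde H_n+n(\beta+t))^2}{(2n+\alpha+\beta)^2}-\frac{2(\widetilde H_n+n(\beta+t))^3}{(2n+\alpha+\beta)^3}\Big), \end{aligned}$$ where $$\begin{aligned} Z_n:=(2n+\alpha+\beta)\Big(&(2n-1+\alpha+\beta)(2n+1+\alpha+\beta)-\Big(2n+\alpha+\beta+\frac{1}{2n+\alpha+\beta}\Big)(\beta+t)\\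 &-(2n+1+\alpha+\beta)\big(\widetilde H_{n-1}+(n-1)(\beta+t)\big)+\frac{2(\widetilde H_n+n(\beta+t))}{(2n+\alpha+\beta)^2}\\ &+(2n-1+\alpha+\beta)\big(\widetilde H_{n+1}+(n+1)(\beta+t)\big)\Big), \end{aligned}$$ $$\begin{aligned} \widetilde Z_n:=\ & nt+\frac{(-2n-\alpha+t)(\widetilde H_n+n(\beta+t))}{2n+\alpha+\beta}-\frac{(\widetilde H_n+n(\beta+t))^2}{(2n+\alpha+\beta)^2}\\ &-\frac{1-(2n+\alpha+\beta)^2}{Z_n}\Big(-nt(\beta+t)+\frac{(\alpha\beta+2\beta(n-t)+(2n-t)t)(\widetilde H_n+n(\beta+t))}{2n+\alpha+\beta}\\ &\qquad+\frac{(-\alpha+2\beta-2n+3t)(\widetilde H_n+n(\beta+t))^2}{(2n+\alpha+\beta)^2}-\frac{2(\widetilde H_n+n(\beta+t))^3}{(2n+\alpha+\beta)^3}\Big). \end{aligned}$$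
   Context: Convention: $D_0:=1$, so $H_0=0$ and $\widetilde H_0=0$. *)

(* Defs.v *)
From HB Require Import structures.
From mathcomp Require Import all_boot all_order all_algebra.
From mathcomp Require Import all_classical all_reals all_analysis.
Set Implicit Arguments.
Unset Strict Implicit.
Unset Printing Implicit Defensive.
Import Order.TTheory GRing.Theory Num.Theory.
Import numFieldNormedType.Exports.
Local Open Scope classical_set_scope.
Local Open Scope ring_scope.

(* At the endpoint x = 0, where the library sets t / 0 = 0, the value is
   irrelevant: it only affects a null set. *)
Definition weight (R : realType) (alpha beta t x : R) : R :=
  expR (- (t / x)) * x `^ alpha * (1 - x) `^ beta.

Definition moment (R : realType) (alpha beta t : R) (k : nat) : R :=
  (\int[@lebesgue_measure R]_(x in `[0, 1]) (x ^+ k * weight alpha beta t x))%R.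

(* For n = 0 this is the empty determinant, equal to 1. *)
Definition hankel (R : realType) (alpha beta : R) (n : nat) (t : R) : R :=
  \det (\matrix_(i < n, j < n) moment alpha beta t (i + j)).

Definition Hn (R : realType) (alpha beta t : R) (n : nat) : R :=
  t * derive1 (fun s : R => ln (hankel alpha beta n s)) t.

Definition Htilde (R : realType) (alpha beta t : R) (n : nat) : R :=
  Hn alpha beta t n - n%:R * (n%:R + alpha + beta).

Definition Hshift (R : realType) (alpha beta t : R) (n : nat) : R :=
  Htilde alpha beta t n + n%:R * (beta + t).

(* A cubic polynomial in Hshift / (2 n + alpha + beta). *)
Definition cubic (R : realType) (alpha beta t : R) (n : nat) : R :=
  let N := n%:R : R in
  let c := 2 * N + alpha + beta in
  let h := Hshift alpha beta t n in
  - (N * t * (beta + t))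
  + (alpha * beta + 2 * beta * (N - t) + (2 * N - t) * t) * h / c
  + (- alpha + 2 * beta - 2 * N + 3 * t) * h ^+ 2 / c ^+ 2
  - 2 * h ^+ 3 / c ^+ 3.

(* Meant for 1 <= n, so that n.-1 is the true predecessor. *)
Definition Zn (R : realType) (alpha beta t : R) (n : nat) : R :=
  let N := n%:R : R in
  let c := 2 * N + alpha + beta in
  let h := Hshift alpha beta t in
  c * ((2 * N - 1 + alpha + beta) * (2 * N + 1 + alpha + beta)
       - (c + 1 / c) * (beta + t)
       - (2 * N + 1 + alpha + beta) * h n.-1
       + 2 * h n / c ^+ 2
       + (2 * N - 1 + alpha + beta) * h n.+1).

(* Zn is negative whenever alpha, beta, t > 0 and 1 <= n, so dividing by it is
   harmless. *)
Definition Ztilde (R : realType) (alpha beta t : R) (n : nat) : R :=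
  let N := n%:R : R in
  let c := 2 * N + alpha + beta in
  let h := Hshift alpha beta t n in
  N * t + (- 2 * N - alpha + t) * h / c - h ^+ 2 / c ^+ 2
  - (1 - c ^+ 2) / Zn alpha beta t n * cubic alpha beta t n.

(* Main.v *)
(* Let P_n be the monic orthogonal polynomials of the weight and h_n their
   square norms.  The Hankel matrix is diagonal in the basis P_n, so
   differentiating its determinant gives H_n = - sum_(j < n) a_j, where
   a_j = t <P_j^2 / x> / h_j.  Integrating by parts against P_n^2, P_n P_{n-1}
   and x P_n^2 expresses the residues of the ladder operators
     A_n(z) = a_n / z^2 + c_n / (z (1 - z)),
     B_n(z) = r_n / z^2 + (s_n - n) / z + s_n / (1 - z)
   by one another: Htilde_n - Htilde_{n+1} = c_n = a_n + 2n + 1 + alpha + beta,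
   and r_n - s_n = q_n is the subleading coefficient of P_n, which equals
   (Htilde_n + n (beta + t)) / (2n + alpha + beta).  Expanding one factor of
   P_n P_{n-1} at 0 or at 1 gives three quadratic relations with
   beta_n = h_n / h_{n-1}:
     r^2 - t r = beta_n a a',   s^2 + beta s = beta_n c c',
     2 r (s - n) - t (s - n) - alpha r = beta_n (a c' + c a').
   Since c - a and c' - a' are explicit, two combinations of them are linear in
   r and s; they say beta_n Z_n = cubic and Ztilde_n = (2n + alpha + beta) s_n.
   The third relation is then the claim.  Dividing by Z_n is legitimate because
   a_n >= t and q_n >= - n force Z_n < 0. *)
Require Import Defs.
From HB Require Import structures.
From mathcomp Require Import all_boot all_order all_algebra fingroup perm.
From mathcomp Require Import all_classical all_reals all_analysis.
From mathcomp Require Import ring lra zify.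
Set Implicit Arguments.
Unset Strict Implicit.
Unset Printing Implicit Defensive.
Import Order.TTheory GRing.Theory Num.Theory.
Import numFieldNormedType.Exports.
Local Open Scope classical_set_scope.
Local Open Scope ring_scope.

(** * Orthogonal polynomials of a positive functional *)

Section OrthogonalPolynomials.
Context (R : realFieldType) (L : {scalar {poly R}}).
Hypothesis L_gt0 : forall p : {poly R}, p != 0 -> 0 < L (p ^+ 2).

(* The second component is the previous polynomial, 0 at the start. *)
Definition orthopoly_step (pq : {poly R} * {poly R}) :=
  (('X - (L ('X * pq.1 ^+ 2) / L (pq.1 ^+ 2))%:P) * pq.1
     - (L (pq.1 ^+ 2) / L (pq.2 ^+ 2)) *: pq.2, pq.1).

(* Locked so that rewriting with ring laws does not unfold the recursion. *)
Definition orthopoly n : {poly R} := locked (iter n orthopoly_step (1, 0)).1.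
Local Notation P := orthopoly.

Definition sqnorm n := L (P n ^+ 2).
Definition jacobi_diag n := L ('X * P n ^+ 2) / sqnorm n.
Definition subcoef n := - \sum_(j < n) jacobi_diag j.

Lemma orthopoly0 : P 0 = 1. Proof. by rewrite /orthopoly -lock. Qed.

Lemma orthopoly1 : P 1 = 'X - (jacobi_diag 0)%:P.
Proof. by rewrite /jacobi_diag /sqnorm /orthopoly -!lock /= scaler0 subr0 mulr1. Qed.

Lemma orthopolySS n :
  P n.+2 = ('X - (jacobi_diag n.+1)%:P) * P n.+1
           - (sqnorm n.+1 / sqnorm n) *: P n.
Proof. by rewrite /jacobi_diag /sqnorm /orthopoly -!lock. Qed.

Lemma size_monic_orthopoly n : size (P n) = n.+1 /\ P n \is monic.
Proof.
(* The recurrence reaches back two indices, so the induction carries two consecutive polynomials. *)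
suff: (size (P n) = n.+1 /\ P n \is monic)
   /\ (size (P n.+1) = n.+2 /\ P n.+1 \is monic) by case.
elim: n => [|n [IH1 [sP mP]]].
  by rewrite orthopoly0 orthopoly1 size_polyC oner_eq0 size_XsubC monicXsubC monic1.
split=> //; set q := ('X - (jacobi_diag n.+1)%:P) * P n.+1.
have sq : size q = n.+3.
  by rewrite size_monicM ?monicXsubC ?size_XsubC ?sP // -size_poly_eq0 sP.
have lt : (size (- ((sqnorm n.+1 / sqnorm n) *: P n)) < size q)%N.
  by rewrite size_polyN sq (leq_ltn_trans (size_scale_leq _ _)) // IH1.1.
rewrite orthopolySS -/q size_polyDl // sq; split=> //.
by rewrite monicE lead_coefDl // -monicE monicMl ?monicXsubC.
Qed.

Lemma size_orthopoly n : size (P n) = n.+1.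
Proof. by case: (size_monic_orthopoly n). Qed.

Lemma orthopoly_lead n : (P n)`_n = 1.
Proof.
by case: (size_monic_orthopoly n) => sP /monicP; rewrite /lead_coef sP.
Qed.

Lemma orthopoly_neq0 n : P n != 0.
Proof. by rewrite -size_poly_eq0 size_orthopoly. Qed.

Lemma sqnorm_gt0 n : 0 < sqnorm n.
Proof. exact/L_gt0/orthopoly_neq0. Qed.

Lemma sqnorm_neq0 n : sqnorm n != 0.
Proof. by rewrite gt_eqF ?sqnorm_gt0. Qed.

Lemma mulX_orthopoly n : 'X * P n = P n.+1 + jacobi_diag n *: P n
  + (if n is m.+1 then (sqnorm m.+1 / sqnorm m) *: P m else 0).
Proof.
case: n => [|n]; first by rewrite orthopoly1 orthopoly0 -mul_polyC; ring.
by rewrite orthopolySS -!mul_polyC; ring.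
Qed.

(** Strong induction on [j] through the recurrence for P_(j+2). For i = j+1 and i = j the two
    recurrence coefficients are exactly those that cancel the remaining terms. For i < j, X P_i is a
    combination of polynomials of index at most j, all orthogonal to P_(j+1). *)
Lemma orthopoly_orthogonal i j : (i < j)%N -> L (P i * P j) = 0.
Proof.
elim/ltn_ind: j i => -[//|[_ [|//] _|j IH i]].
  rewrite orthopoly0 orthopoly1 mul1r linearB /= /jacobi_diag /sqnorm orthopoly0.
  rewrite -[X in _ - L X]alg_polyC linearZ /= expr1n mulr1 divfK ?subrr //.
  by rewrite -(expr1n _ 2) gt_eqF // L_gt0 ?oner_eq0.
have orth k l : (k < j.+2)%N -> (l < j.+2)%N -> k != l -> L (P k * P l) = 0.
  rewrite neq_ltn => kj lj /orP[] lt; first exact: IH.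
  by rewrite mulrC; exact: IH.
have expand p : L (p * P j.+2) = L (('X * p) * P j.+1)
    - jacobi_diag j.+1 * L (p * P j.+1) - sqnorm j.+1 / sqnorm j * L (p * P j).
  rewrite orthopolySS -!linearZ -!linearB /=; congr (L _).
  by rewrite -!mul_polyC; ring.
rewrite expand ltnS leq_eqVlt => /predU1P[->|].
  rewrite (orth j.+1 j); [|lia..]; rewrite mulr0 subr0 -mulrA -expr2.
  by rewrite -[L (P j.+1 ^+ 2)]/(sqnorm j.+1) divfK ?subrr ?sqnorm_neq0.
rewrite ltnS leq_eqVlt => /predU1P[->|ij].
  rewrite (orth j j.+1); [|lia..]; rewrite mulr0 subr0.
  rewrite -expr2 -/(sqnorm j) divfK ?sqnorm_neq0 // mulX_orthopoly.
  rewrite !mulrDl !linearD /= -scalerAl linearZ /=.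
  rewrite (orth j j.+1); [|lia..]; rewrite mulr0 addr0 -expr2 addrAC subrr add0r.
  case: j {expand} IH orth => [|k] IH orth; first by rewrite mul0r linear0.
  by rewrite -scalerAl linearZ /= orth ?mulr0 //; lia.
rewrite (orth i j.+1); [|lia..]; rewrite (orth i j); [|lia..].
rewrite !mulr0 !subr0 mulX_orthopoly !mulrDl !linearD /= -scalerAl linearZ /=.
rewrite (orth i.+1); [|lia..]; rewrite (orth i); [|lia..].
rewrite mulr0 !add0r; case: i ij => [|k] ij; first by rewrite mul0r linear0.
by rewrite -scalerAl linearZ /= orth ?mulr0 //; lia.
Qed.

Lemma orthopoly_low n (p : {poly R}) : (size p <= n)%N -> L (P n * p) = 0.
Proof.
move: p; suff low m : (m <= n)%N ->
    forall p : {poly R}, (size p <= m)%N -> L (P n * p) = 0.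
  by move=> p; exact: low.
elim: m => [|m IH] mn p.
  by rewrite leqn0 size_poly_eq0 => /eqP->; rewrite mulr0 linear0.
move=> sp; have -> : p = p`_m *: P m + (p - p`_m *: P m) by rewrite addrC subrK.
rewrite mulrDr linearD /= -scalerAr linearZ /= mulrC.
rewrite [P n * P m]mulrC orthopoly_orthogonal // mul0r add0r IH ?(ltnW mn) //.
apply/leq_sizeP => k; rewrite leq_eqVlt coefB coefZ => /predU1P[<-|mk].
  by rewrite orthopoly_lead mulr1 subrr.
rewrite [p`_k]nth_default ?(leq_trans sp) // [(P m)`_k]nth_default.
  by rewrite mulr0 subr0.
by rewrite size_orthopoly.
Qed.

Lemma orthopoly_top n (p : {poly R}) : (size p <= n.+1)%N ->
  L (P n * p) = p`_n * sqnorm n.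
Proof.
move=> sp; have -> : p = p`_n *: P n + (p - p`_n *: P n) by rewrite addrC subrK.
rewrite mulrDr linearD /= -scalerAr linearZ /= orthopoly_low; last first.
  apply/leq_sizeP => k; rewrite leq_eqVlt coefB coefZ => /predU1P[<-|nk].
    by rewrite orthopoly_lead mulr1 subrr.
  rewrite [p`_k]nth_default ?(leq_trans sp) // [(P n)`_k]nth_default.
    by rewrite mulr0 subr0.
  by rewrite size_orthopoly.
by rewrite addr0 -expr2 coefD coefB !coefZ orthopoly_lead mulr1 subrr addr0.
Qed.

Lemma subcoefS n : subcoef n.+1 = subcoef n - jacobi_diag n.
Proof. by rewrite /subcoef big_ord_recr opprD. Qed.

Lemma orthopoly_subcoef n : (P n.+1)`_n = subcoef n.+1.
Proof.
elim: n => [|n IH].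
  by rewrite orthopoly1 coefB coefX coefC /subcoef big_ord1 sub0r.
rewrite orthopolySS subcoefS -IH coefB coefZ mulrBl coefB coefXM /= coefCM.
by rewrite orthopoly_lead mulr1 [(P n)`_n.+1]nth_default ?size_orthopoly // mulr0 subr0.
Qed.

(** X^2 P_n' and n X P_n share their top coefficient. Their difference has degree at most n, with
    coefficient (n-1) p - n p = -p at X^n for p = [subcoef n], and [orthopoly_top] reads it off. *)
Lemma orthopoly_XXderiv_self n :
  L (P n * ('X^2 * (P n)^`())) = (n%:R * jacobi_diag n - subcoef n) * sqnorm n.
Proof.
have -> : 'X^2 * (P n)^`()
    = n%:R *: ('X * P n) + ('X^2 * (P n)^`() - n%:R *: ('X * P n)).
  by rewrite addrC subrK.
rewrite mulrDr linearD /= -scalerAr linearZ /=.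
rewrite mulrCA -expr2 orthopoly_top.
  rewrite mulrBl /jacobi_diag mulrA divfK ?sqnorm_neq0 //; congr (_ + _).
  rewrite -mulNr; congr (_ * _).
  case: n => [|n]; first by rewrite scale0r subr0 coefXnM /subcoef big_ord0 !oppr0.
  rewrite coefB coefZ coefXnM coefXM /= subSS subn1 /=.
  case: n => [|n]; first by rewrite /subcoef /= orthopoly_subcoef /subcoef; ring.
  rewrite /= coef_deriv orthopoly_subcoef -[n.+2%:R]natr1 -mulr_natl; ring.
apply/leq_sizeP => k; rewrite coefB coefZ coefXnM coefXM.
case: k => [//|[|k]] /=.
  by case: n => // _; rewrite orthopoly0 coefC mul0r subrr.
rewrite !subSS subn0 coef_deriv ltnS leq_eqVlt => /predU1P[->|nk].
  by rewrite orthopoly_lead mulr1 subrr.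
by rewrite nth_default ?size_orthopoly // mul0rn mulr0 subr0.
Qed.

Lemma size_orthopoly_deriv n : (size (P n)^`() <= n)%N.
Proof.
rewrite -ltnS (leq_trans (lt_size_deriv (orthopoly_neq0 n))) //.
by rewrite size_orthopoly.
Qed.

Lemma size_orthopoly_Xderiv n : (size ('X * (P n)^`())%R <= n.+1)%N.
Proof.
apply: (leq_trans (size_polyMleq _ _)).
by rewrite size_polyX ltnS size_orthopoly_deriv.
Qed.

Lemma orthopoly_deriv_self n : L (P n * (P n)^`()) = 0.
Proof. by rewrite orthopoly_low ?size_orthopoly_deriv. Qed.

Lemma orthopoly_Xderiv_self n : L (P n * ('X * (P n)^`())) = n%:R * sqnorm n.
Proof.
rewrite orthopoly_top ?size_orthopoly_Xderiv // coefXM; congr (_ * _).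
by case: n => [//|n]; rewrite /= coef_deriv orthopoly_lead.
Qed.

Lemma orthopoly_deriv_next n : L (P n * (P n.+1)^`()) = n.+1%:R * sqnorm n.
Proof.
by rewrite orthopoly_top ?size_orthopoly_deriv // coef_deriv orthopoly_lead.
Qed.

Lemma orthopoly_deriv_prev n : L (P n.+1 * (P n)^`()) = 0.
Proof. by rewrite orthopoly_low // (leq_trans (size_orthopoly_deriv n)). Qed.

Lemma orthopoly_Xderiv_prev n : L (P n.+1 * ('X * (P n)^`())) = 0.
Proof. by rewrite orthopoly_low ?size_orthopoly_Xderiv. Qed.

Lemma orthopoly_Xderiv_next n :
  L (P n * ('X * (P n.+1)^`())) = - subcoef n.+1 * sqnorm n.
Proof.
have -> : 'X * (P n.+1)^`()
    = n.+1%:R *: P n.+1 + ('X * (P n.+1)^`() - n.+1%:R *: P n.+1).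
  by rewrite addrC subrK.
rewrite mulrDr linearD /= -scalerAr linearZ /= orthopoly_orthogonal // mulr0 add0r.
rewrite orthopoly_top.
  rewrite coefB coefZ coefXM orthopoly_subcoef; congr (_ * _).
  case: n => [|n]; first by rewrite /=; ring.
  by rewrite /= coef_deriv orthopoly_subcoef -[n.+2%:R]natr1 -mulr_natl; ring.
apply/leq_sizeP => k; rewrite coefB coefZ coefXM; case: k => [//|k] /=.
rewrite coef_deriv ltnS leq_eqVlt => /predU1P[<-|nk].
  by rewrite orthopoly_lead mulr1 subrr.
by rewrite nth_default ?size_orthopoly // mul0rn mulr0 subr0.
Qed.

End OrthogonalPolynomials.

(** * Quadratic relations for the perturbed Jacobi functional *)

(** Used at the endpoints 0 and 1: the factor X - x absorbs the singular factor of the functional,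
    and orthogonality then sees only the top coefficient of the quotient. *)
Lemma taylor1_poly (R : idomainType) (x : R) (p : {poly R}) n :
  (size p <= n.+2)%N ->
  exists q : {poly R}, [/\ p = p.[x]%:P + ('X - x%:P) * q,
    (size q <= n.+1)%N & q`_n = p`_n.+1].
Proof.
move=> sp; have : root (p - p.[x]%:P) x by rewrite /root !hornerE subrr.
move=> /factor_theorem[q pq].
have pE : p = p.[x]%:P + ('X - x%:P) * q by rewrite mulrC -pq addrC subrK.
have coefq k : p`_k.+1 = q`_k - x * q`_k.+1.
  by rewrite {1}pE coefD coefC add0r mulrBl coefB coefXM coefCM.
have sq : (size q <= n.+1)%N.
  have [->|q0] := eqVneq q 0; first by rewrite size_poly0.
  have := congr1 (fun p : {poly R} => size p) pq.
  rewrite /= size_Mmonic ?monicXsubC // size_XsubC addn2 /= -ltnS => <-.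
  rewrite (leq_trans (size_polyD _ _)) // geq_max size_polyN sp.
  by rewrite (leq_trans (size_polyC_leq1 _)).
exists q; split=> //.
by rewrite coefq [q`_n.+1]nth_default // mulr0 subr0.
Qed.

Section PerturbedJacobi.
Context (R : realFieldType) (alpha beta t : R) (K : {scalar {poly R}}).

(* K p stands for the integral of p x^(alpha-2) (1-x)^beta e^(-t/x) on [0, 1].
   dK p stands for beta times the integral of
   p x^alpha (1-x)^(beta-1) e^(-t/x), integrated by parts. *)
Definition dK (p : {poly R}) := K ('X^2 * p^`() + (alpha *: 'X + t%:P) * p).
Definition K1 (p : {poly R}) := K ('X * p).
Definition K2 (p : {poly R}) := K ('X^2 * p).

Lemma K1_linear : scalar K1.
Proof. by move=> a p q; rewrite /K1 mulrDr -scalerAr linearP. Qed.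
HB.instance Definition _ := GRing.isLinear.Build R {poly R} R _ K1 K1_linear.

Lemma K2_linear : scalar K2.
Proof. by move=> a p q; rewrite /K2 mulrDr -scalerAr linearP. Qed.
HB.instance Definition _ := GRing.isLinear.Build R {poly R} R _ K2 K2_linear.

Lemma dK_linear : scalar dK.
Proof.
move=> a p q; rewrite /dK -linearP derivD derivZ; congr (K _).
by rewrite -!mul_polyC; ring.
Qed.
HB.instance Definition _ := GRing.isLinear.Build R {poly R} R _ dK dK_linear.

(** Positivity is required beyond squares because the bounds on [acoef] and [jacobi_diag] test [K]
    on X^k (1 - X) p^2. *)
Hypothesis K_gt0 : forall p : {poly R}, p != 0 ->
  (forall x, 0 <= x <= 1 -> 0 <= p.[x]) -> 0 < K p.
Hypothesis K_ibp : forall p, dK ((1 - 'X) * p) = beta * K2 p.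

Lemma K2_gt0 (p : {poly R}) : p != 0 -> 0 < K2 (p ^+ 2).
Proof.
move=> p0; apply: K_gt0 => [|x _].
  by rewrite mulf_neq0 ?expf_neq0 // polyX_eq0.
by rewrite hornerM hornerXn horner_exp mulr_ge0 ?sqr_ge0.
Qed.

Local Notation P := (orthopoly K2).
Local Notation h := (sqnorm K2).
Local Notation jd := (jacobi_diag K2).
Local Notation p1 := (subcoef K2).

Lemma dKE p : dK p = K2 p^`() + alpha * K1 p + t * K p.
Proof.
rewrite /dK /K2 /K1 -!linearZ -!linearD /=; congr (K _).
by rewrite -!mul_polyC; ring.
Qed.

Lemma K1X p : K1 ('X * p) = K2 p.
Proof. by rewrite /K1 /K2 mulrA expr2. Qed.

Lemma dKX p : dK ('X * p) = dK p - beta * K2 p.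
Proof.
by rewrite -K_ibp -linearB /=; congr (dK _); ring.
Qed.

(** Expand [dK ('X * p)] by [dKE] and compare with [dKX]. The derivative now enters only through X
    p', which does not raise the degree, so products of orthogonal polynomials can be evaluated from
    leading coefficients. *)
Lemma dK_euler p :
  dK p = (1 + alpha + beta) * K2 p + K2 ('X * p^`()) + t * K1 p.
Proof.
have := dKX p; rewrite dKE derivM derivX mul1r linearD /= K1X -/(K1 p) => E.
rewrite -[LHS](subrK (beta * K2 p)) -E; ring.
Qed.

(* acoef n and ccoef n are the coefficients of the ladder operator A_n;
   rcoef n and scoef n are those of B_(n+1), a shift of index. *)
Definition acoef n := t * K1 (P n ^+ 2) / h n.
Definition ccoef n := dK (P n ^+ 2) / h n.
Definition rcoef n := t * K1 (P n.+1 * P n) / h n.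
Definition scoef n := dK (P n.+1 * P n) / h n.

Let h_neq0 n : h n != 0. Proof. exact/sqnorm_neq0/K2_gt0. Qed.

Let h_gt0 n : 0 < h n. Proof. exact/sqnorm_gt0/K2_gt0. Qed.

Lemma ccoefE n : ccoef n = acoef n + 2 * n%:R + 1 + alpha + beta.
Proof.
apply: (mulIf (h_neq0 n)); rewrite !mulrDl /ccoef /acoef !divfK //.
rewrite dK_euler deriv_exp -/(h n).
have -> : 'X * ((P n)^`() * P n ^+ 1 *+ 2) = 2%:R *: (P n * ('X * (P n)^`())).
  by rewrite -mul_polyC; ring.
rewrite linearZ /= (orthopoly_Xderiv_self K2_gt0); ring.
Qed.

Lemma rcoef_sub_scoef n : rcoef n - scoef n = p1 n.+1.
Proof.
apply: (mulIf (h_neq0 n)); rewrite mulrBl /rcoef /scoef !divfK //.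
rewrite dK_euler derivM.
have -> : 'X * ((P n.+1)^`() * P n + P n.+1 * (P n)^`())
  = P n * ('X * (P n.+1)^`()) + P n.+1 * ('X * (P n)^`()) by ring.
rewrite [K2 (_ + _)]linearD /=.
rewrite (orthopoly_Xderiv_next K2_gt0) (orthopoly_Xderiv_prev K2_gt0).
have -> : K2 (P n.+1 * P n) = 0.
  by rewrite mulrC (orthopoly_orthogonal K2_gt0).
ring.
Qed.

(** The integration by parts against x P_n^2. Compared with [ccoefE], it ties [jacobi_diag] to
    [acoef]. *)
Lemma ccoef_jacobi_diag n :
  ccoef n = (2 * n%:R + 2 + alpha + beta) * jd n - 2 * p1 n + t + beta.
Proof.
apply: (mulIf (h_neq0 n)); rewrite /ccoef !divfK //.
rewrite -[LHS](subrK (beta * h n)) -dKX dK_euler derivM derivX deriv_exp K1X.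
have -> : 'X * (1 * P n ^+ 2 + 'X * ((P n)^`() * P n ^+ 1 *+ 2))
  = 'X * P n ^+ 2 + 2%:R *: (P n * ('X^2 * (P n)^`())).
  by rewrite -mul_polyC; ring.
rewrite linearD linearZ /= (orthopoly_XXderiv_self K2_gt0).
have -> : K2 ('X * P n ^+ 2) = jd n * h n by rewrite /jacobi_diag divfK.
rewrite -/(h n); ring.
Qed.

Lemma K_onem_gt0 k (p : {poly R}) : p != 0 ->
  0 < K ('X^k * ((1 - 'X) * p ^+ 2)).
Proof.
move=> p0; apply: K_gt0.
  rewrite !mulf_neq0 ?expf_neq0 ?polyX_eq0 //.
  by rewrite -size_poly_eq0 -opprB size_polyN size_XsubC.
move=> x /andP[x0 x1].
rewrite hornerM hornerXn hornerM horner_exp hornerD hornerN hornerX -polyC1 hornerC.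
by rewrite mulr_ge0 ?exprn_ge0 // mulr_ge0 ?subr_ge0 ?sqr_ge0.
Qed.

(** Since 1/x >= 1 on the interval, the mean of 1/x against P_n^2 is at least 1; formally, [K1] is
    nonnegative on (1 - X) P_n^2. *)
Lemma acoef_ge n : t >= 0 -> t <= acoef n.
Proof.
move=> t0; rewrite /acoef -mulrA ler_peMr // ler_pdivlMr // mul1r -subr_ge0.
have := K_onem_gt0 1 (orthopoly_neq0 K2 n) => /ltW.
have -> : h n = K1 ('X * P n ^+ 2) by rewrite K1X.
by rewrite expr1 mulrBl mul1r mulrBr linearB.
Qed.

Lemma jacobi_diag_le1 n : jd n <= 1.
Proof.
rewrite /jacobi_diag ler_pdivrMr // mul1r -subr_ge0.
have := K_onem_gt0 2 (orthopoly_neq0 K2 n) => /ltW.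
by rewrite mulrBl mul1r mulrBr linearB.
Qed.

Lemma subcoef_ge n : - n%:R <= p1 n.
Proof.
rewrite /subcoef lerN2 -[X in _ <= X%:R]card_ord -sumr_const.
by apply: ler_sum => i _; exact: jacobi_diag_le1.
Qed.

Lemma dK_at1 n (p : {poly R}) : (size p <= n.+2)%N ->
  dK (P n * p) = p.[1] * dK (P n) - beta * p`_n.+1 * h n.
Proof.
move=> /(taylor1_poly 1)[q [pE sq <-]].
have -> : P n * p = p.[1] *: P n - (1 - 'X) * (P n * q).
  by rewrite {1}pE -mul_polyC polyC1; ring.
by rewrite linearB linearZ /= K_ibp (orthopoly_top K2_gt0) // mulrA.
Qed.

Lemma K1_at0 n (p : {poly R}) : (size p <= n.+2)%N ->
  K1 (P n * p) = p.[0] * K1 (P n) + p`_n.+1 * h n.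
Proof.
move=> /(taylor1_poly 0)[q [pE sq <-]].
have -> : P n * p = p.[0] *: P n + 'X * (P n * q).
  by rewrite {1}pE -mul_polyC; ring.
by rewrite linearD linearZ /= K1X (orthopoly_top K2_gt0).
Qed.

Lemma K_at0 n (p : {poly R}) : (size p <= n.+2)%N ->
  K (P n * p) = p.[0] * K (P n) + p`_1 * K1 (P n).
Proof.
move=> sp; have [q [pE sq _]] := taylor1_poly 0 sp.
have q0 : q.[0] = p`_1.
  by rewrite {1}pE subr0 coefD coefC coefXM add0r horner_coef0.
have -> : P n * p = p.[0] *: P n + 'X * (P n * q).
  by rewrite {1}pE -mul_polyC; ring.
rewrite linearD linearZ /= -/(K1 _) K1_at0 ?(leq_trans sq) //.
by rewrite q0 [q`_n.+1]nth_default // mul0r addr0.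
Qed.

(** By [dK_at1] every factor splits into a value at 1 times [dK] of a single polynomial, and both
    sides become P_n(1) P_(n+1)(1) dK(P_n) dK(P_(n+1)). The shift by [beta * h n] is the top
    coefficient term met when P_(n+1) is the one expanded. *)
Lemma dK_quadratic n :
  dK (P n.+1 * P n) * (dK (P n.+1 * P n) + beta * h n)
  = dK (P n.+1 ^+ 2) * dK (P n ^+ 2).
Proof.
have sz := size_orthopoly K2.
have E : dK (P n.+1 * P n) + beta * h n = (P n.+1).[1] * dK (P n).
  by rewrite mulrC dK_at1 ?sz // orthopoly_lead mulr1 subrK.
have top k l : (k < l)%N -> (P k)`_l = 0 by move=> kl; rewrite nth_default ?sz.
by rewrite E !expr2 !dK_at1 ?sz ?top; try lia; ring.
Qed.

Lemma K1_quadratic n :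
  K1 (P n.+1 * P n) * (K1 (P n.+1 * P n) - h n)
  = K1 (P n.+1 ^+ 2) * K1 (P n ^+ 2).
Proof.
have sz := size_orthopoly K2.
have E : K1 (P n.+1 * P n) - h n = (P n.+1).[0] * K1 (P n).
  by rewrite mulrC K1_at0 ?sz // orthopoly_lead mul1r addrK.
have top k l : (k < l)%N -> (P k)`_l = 0 by move=> kl; rewrite nth_default ?sz.
by rewrite E !expr2 !K1_at0 ?sz ?top; try lia; ring.
Qed.

Lemma K_quadratic n :
  (2 * K1 (P n.+1 * P n) - h n) * K (P n.+1 * P n)
  = K1 (P n.+1 ^+ 2) * K (P n ^+ 2) + K (P n.+1 ^+ 2) * K1 (P n ^+ 2).
Proof.
have sz := size_orthopoly K2.
have top k l : (k < l)%N -> (P k)`_l = 0 by move=> kl; rewrite nth_default ?sz.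
have E1 : K1 (P n.+1 * P n) = (P n).[0] * K1 (P n.+1).
  by rewrite K1_at0 ?sz ?top ?mul0r ?addr0 //; lia.
have E2 : K1 (P n.+1 * P n) - h n = (P n.+1).[0] * K1 (P n).
  by rewrite mulrC K1_at0 ?sz // orthopoly_lead mul1r addrK.
have F1 : K (P n.+1 * P n) = (P n).[0] * K (P n.+1) + (P n)`_1 * K1 (P n.+1).
  by rewrite K_at0 ?sz //; lia.
have F2 : K (P n.+1 * P n) = (P n.+1).[0] * K (P n) + (P n.+1)`_1 * K1 (P n).
  by rewrite mulrC K_at0 ?sz.
(* The two copies of [K (P n.+1 * P n)] are expanded differently, by [F2] in the first product and
   by [F1] in the second; this matches the right-hand side term by term. *)
have -> : (2 * K1 (P n.+1 * P n) - h n) * K (P n.+1 * P n)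
  = K1 (P n.+1 * P n) * K (P n.+1 * P n)
    + (K1 (P n.+1 * P n) - h n) * K (P n.+1 * P n) by ring.
have G1 k : K1 (P k ^+ 2) = (P k).[0] * K1 (P k).
  by rewrite expr2 K1_at0 ?sz ?top ?mul0r ?addr0.
have G2 k : K (P k ^+ 2) = (P k).[0] * K (P k) + (P k)`_1 * K1 (P k).
  by rewrite expr2 K_at0 ?sz.
rewrite E2 {1}F2 F1 E1 !G1 !G2; ring.
Qed.

(** The recurrence coefficient beta_(n+1), with the same index shift as [rcoef] and [scoef]. *)
Definition bcoef n := h n.+1 / h n.

Lemma scoef_quadratic n :
  scoef n ^+ 2 + beta * scoef n = bcoef n * ccoef n.+1 * ccoef n.
Proof.
have h1 := h_neq0 n.+1; have h0 := h_neq0 n.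
have -> : bcoef n * ccoef n.+1 * ccoef n
    = dK (P n.+1 ^+ 2) * dK (P n ^+ 2) / h n ^+ 2.
  by rewrite /bcoef /ccoef; field; rewrite h0 h1.
by rewrite -dK_quadratic /scoef; field.
Qed.

Lemma rcoef_quadratic n :
  rcoef n ^+ 2 - t * rcoef n = bcoef n * acoef n.+1 * acoef n.
Proof.
have h1 := h_neq0 n.+1; have h0 := h_neq0 n.
have -> : bcoef n * acoef n.+1 * acoef n
    = t ^+ 2 * (K1 (P n.+1 ^+ 2) * K1 (P n ^+ 2)) / h n ^+ 2.
  by rewrite /bcoef /acoef; field; rewrite h0 h1.
by rewrite -K1_quadratic /rcoef; field.
Qed.

Lemma dK_sqr n :
  dK (P n ^+ 2) = alpha * K1 (P n ^+ 2) + t * K (P n ^+ 2).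
Proof.
rewrite dKE deriv_exp.
have -> : (P n)^`() * P n ^+ 1 *+ 2 = 2%:R *: (P n * (P n)^`()).
  by rewrite -mul_polyC; ring.
by rewrite linearZ /= (orthopoly_deriv_self K2_gt0) mulr0 add0r.
Qed.

Lemma dK_mul_next n : dK (P n.+1 * P n)
  = n.+1%:R * h n + alpha * K1 (P n.+1 * P n) + t * K (P n.+1 * P n).
Proof.
rewrite dKE derivM linearD /= [_^`() * _]mulrC.
by rewrite (orthopoly_deriv_next K2_gt0) (orthopoly_deriv_prev K2_gt0) addr0.
Qed.

(** Subtracting n+1 removes the derivative term of [dK_mul_next]. What remains of each [dK] is alpha
    [K1] + t [K]: the alpha parts match by [K1_quadratic], the t parts by [K_quadratic]. *)
Lemma mixed_quadratic n (r := scoef n - n.+1%:R) :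
  2 * rcoef n * r - t * r - alpha * rcoef n
  = bcoef n * (acoef n.+1 * ccoef n + ccoef n.+1 * acoef n).
Proof.
have h1 := h_neq0 n.+1; have h0 := h_neq0 n.
have rE : r = (alpha * K1 (P n.+1 * P n) + t * K (P n.+1 * P n)) / h n.
  by rewrite /r /scoef dK_mul_next; field.
have -> : bcoef n * (acoef n.+1 * ccoef n + ccoef n.+1 * acoef n)
  = (2 * alpha * t * (K1 (P n.+1 ^+ 2) * K1 (P n ^+ 2))
     + t ^+ 2 * (K1 (P n.+1 ^+ 2) * K (P n ^+ 2)
                 + K (P n.+1 ^+ 2) * K1 (P n ^+ 2))) / h n ^+ 2.
  by rewrite /bcoef /acoef /ccoef !dK_sqr; field; rewrite h0 h1.
by rewrite -K1_quadratic -K_quadratic rE /rcoef; field.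
Qed.

(** Equating the two formulas for [ccoef] gives the increment of the left-hand side, so the identity
    telescopes. The sum of [acoef] is minus H_n, hence the link with [Hshift]. *)
Lemma kappa_subcoef n :
  (2 * n%:R + alpha + beta) * p1 n
  = - \sum_(j < n) acoef j - n%:R * (n%:R + alpha - t).
Proof.
elim: n => [|n IH]; first by rewrite /subcoef !big_ord0; ring.
have := ccoef_jacobi_diag n; rewrite ccoefE big_ord_recr /= subcoefS => E.
move: IH; set S := \sum_(_ < _) _ => IH.
have -> : acoef n = (2 * n%:R + 2 + alpha + beta) * jd n - 2 * p1 n + t + beta
  - (2 * n%:R + 1 + alpha + beta) by rewrite -E; ring.
have -> : S = - (n%:R * (n%:R + alpha - t)) - (2 * n%:R + alpha + beta) * p1 n.
  by rewrite IH; ring.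
rewrite -[n.+1%:R]natr1; ring.
Qed.

End PerturbedJacobi.

(** * Elimination between the quadratic relations *)

Section DifferenceEquation.
Context (F : fieldType) (N alpha beta t a a' r s b q : F).
Let kappa := 2 * N + alpha + beta.
Let c := a + kappa + 1.
Let c' := a' + kappa - 1.
Hypothesis rs : r = s + q.
Hypothesis r_eq : r ^+ 2 - t * r = b * a * a'.
Hypothesis s_eq : s ^+ 2 + beta * s = b * c * c'.
Hypothesis mixed_eq : 2 * r * (s - N) - t * (s - N) - alpha * r
  = b * (a * c' + c * a').
Let Z := kappa * (a * a' - c * c') - (kappa ^+ 2 - 1) * (2 * q - beta - t).

(* r_eq + s_eq - mixed_eq has right-hand side b (c - a) (c' - a'), and
   (c - a) (c' - a') = kappa^2 - 1. *)
Lemma kappa_s :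
  kappa * s = N * t + (- 2 * N - alpha + t) * q - q ^+ 2 - (1 - kappa ^+ 2) * b.
Proof.
have -> : (1 - kappa ^+ 2) * b = - (b * a * a' + b * c * c' - b * (a * c' + c * a')).
  by rewrite /c /c'; ring.
rewrite -r_eq -s_eq -mixed_eq rs /kappa; ring.
Qed.

(** Both b (a a' - c c') and b (kappa^2 - 1) are linear in s once r = s + q. Their s-terms, after
    multiplication by kappa and by 2 q - beta - t, are equal and cancel, which explains the shape of
    [Z]. *)
Lemma b_Z : b * Z = - (N * t * (beta + t))
  + (alpha * beta + 2 * beta * (N - t) + (2 * N - t) * t) * q
  + (- alpha + 2 * beta - 2 * N + 3 * t) * q ^+ 2 - 2 * q ^+ 3.
Proof.
have -> : b * Z = kappa * (b * a * a' - b * c * c')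
  - (b * a * a' + b * c * c' - b * (a * c' + c * a')) * (2 * q - beta - t).
  by rewrite /Z /c /c'; ring.
rewrite -r_eq -s_eq -mixed_eq rs /kappa; ring.
Qed.

Lemma mixed_eq_s :
  N * t - (2 * N + alpha) * q + s * (- 2 * N - alpha - t + 2 * q) + 2 * s ^+ 2
  = b * (a * c' + c * a').
Proof. rewrite -mixed_eq rs; ring. Qed.

End DifferenceEquation.

(** * The weight and its moments *)

Lemma finite_roots (R : realType) (p : {poly R}) : p != 0 ->
  finite_set [set x | root p x].
Proof.
move=> p0; apply: contrapT => /(@infinite_set_fset R _ (size p))[B sB].
apply/negP; rewrite -ltnNge.
apply: max_poly_roots => //; last exact: finmap.fset_uniq.
by apply/allP => x xB; exact: sB.
Qed.

Section Weight.
Context (R : realType) (alpha beta t : R).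
Hypotheses (alpha_gt0 : 0 < alpha) (beta_gt0 : 0 < beta) (t_gt0 : 0 < t).
Local Notation w := (weight alpha beta t).
Local Notation mu := (@lebesgue_measure R).

Lemma weight_ge0 (x : R) : 0 <= w x.
Proof. by rewrite /weight !mulr_ge0 ?expR_ge0 ?powR_ge0. Qed.

Lemma weight_gt0 (x : R) : 0 < x < 1 -> 0 < w x.
Proof.
by case/andP=> x0 x1; rewrite /weight !mulr_gt0 ?expR_gt0 ?powR_gt0 ?subr_gt0.
Qed.

Lemma weight0 : w 0 = 0.
Proof. by rewrite /weight powR0 ?gt_eqF // mulr0 mul0r. Qed.

(** From exp y >= y^3 / 3!. The cubic order leaves one factor x after the division by x^2 in
    [weight2]. *)
Lemma expRN_div_le (s x : R) : 0 < s -> 0 < x ->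
  expR (- (s / x)) <= 6 * (x / s) ^+ 3.
Proof.
move=> s0 x0; have sx : 0 < s / x by rewrite divr_gt0.
have := @expR_ge1Dxn R (s / x) 2 (ltW sx); rewrite -[(3`!)%:R]/(6%:R) => le.
rewrite expRN -[X in _ <= X]invrK lef_pV2 ?posrE ?expR_gt0 //; last first.
  by rewrite invr_gt0 mulr_gt0 ?exprn_gt0 ?divr_gt0.
apply: le_trans le; rewrite invfM -exprVn invf_div mulrC; lra.
Qed.

Lemma is_derive_weight (x : R) : 0 < x < 1 ->
  is_derive x 1 w (w x * (alpha / x - beta / (1 - x) + t / x ^+ 2)).
Proof.
case/andP=> x0 x1; have x1' : 0 < 1 - x by rewrite subr_gt0.
have dE : is_derive x 1 (fun y => expR (- (t / y)))
    (expR (- (t / x)) * (t / x ^+ 2)).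
  apply: is_derive1_comp.
  have d := @is_deriveV R id x 1 1 (lt0r_neq0 x0) (is_derive_id _ _).
  apply: is_derive_eq (is_deriveN (is_deriveZ t d)) _.
  by rewrite /GRing.scale /= mulr1; field; rewrite gt_eqF.
have dA := is_derive1_powR alpha x0.
have dB : is_derive x 1 (fun y : R => (1 - y) `^ beta)
    (- (beta * (1 - x) `^ (beta - 1))).
  have d1 := @is_derive1_powR R beta _ x1'.
  have d2 : is_derive x 1 (fun y : R => 1 - y) (-1).
    have := is_deriveB (is_derive_cst (1 : R) x 1) (is_derive_id x 1).
    by rewrite sub0r.
  have := @is_derive1_comp _ (fun y : R => y `^ beta) (fun y => 1 - y) x _ _ d1 d2.
  by rewrite mulrN1.
have powRB1 (y a : R) : 0 < y -> y `^ (a - 1) = y `^ a / y.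
  by move=> y0; rewrite powRB ?powRr1 ?ltW // (gt_eqF y0) implybT.
have d : is_derive x 1 w _ := is_deriveM (is_deriveM dE dA) dB.
apply: is_derive_eq d _.
rewrite /GRing.scale /= mulrfctE /= !powRB1 // /weight.
by field; rewrite !gt_eqF.
Qed.

(** With this density as base, the integrals against w / x and w / x^2 are also values of a
    functional on polynomials. At x = 0 the division convention gives 0, which is the limit. *)
Definition weight2 x := w x / x ^+ 2.

Lemma weight2_ge0 (x : R) : 0 <= weight2 x.
Proof. by rewrite divr_ge0 ?weight_ge0 ?sqr_ge0. Qed.

Lemma powR_le1 (y a : R) : 0 < a -> 0 <= y -> y <= 1 -> y `^ a <= 1.
Proof.
move=> a0 y0 y1; have : y `^ a <= 1 `^ a.
  by apply: ge0_ler_powR => //; [exact: ltW|rewrite nnegrE..].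
by rewrite powR1.
Qed.

Lemma weight2_le (x : R) : 0 < x < 1 ->
  weight2 x <= 6 / t ^+ 3 * (x * (1 - x) `^ beta).
Proof.
case/andP=> x0 x1.
rewrite /weight2 ler_pdivrMr ?exprn_gt0 //.
have -> : 6 / t ^+ 3 * (x * (1 - x) `^ beta) * x ^+ 2
  = 6 * (x / t) ^+ 3 * (1 - x) `^ beta by field; rewrite gt_eqF.
rewrite ler_wpM2r ?powR_ge0 //; apply: le_trans (expRN_div_le t_gt0 x0).
by rewrite ler_piMr ?expR_ge0 // powR_le1 // ltW.
Qed.

Lemma powR_onem_cvg0 (a : R) : 0 < a -> (1 - x) `^ a @[x --> 1^'-] --> 0.
Proof.
move=> a0; apply: (@cvg_comp _ _ _ (fun x : R => 1 - x) (fun y => y `^ a) _ (0^'+)).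
  move=> A [e /= e0 eA]; exists e => //= y ye y1; apply: eA => /=.
    by rewrite sub0r opprB distrC.
  by rewrite subr_gt0.
exact: powR_cvg0.
Qed.

Lemma continuous_weight2 : {within `[0, 1], continuous weight2}.
Proof.
have C0 : 0 <= 6 / t ^+ 3 by rewrite divr_ge0 // exprn_ge0 // ltW.
apply/continuous_within_itvP => //; split.
- move=> x /[!in_itv]/= x01.
  apply/differentiable_continuous/derivable1_diffP.
  have d := is_derive_weight x01.
  have dx : is_derive x 1 (fun y : R => y ^+ 2) (x + x).
    have := is_deriveM (is_derive_id x 1) (is_derive_id x 1).
    by rewrite /GRing.scale /= !mulr1.
  have x20 : x ^+ 2 != 0 by case/andP: x01 => x0 _; rewrite expf_neq0 // gt_eqF.
  have d2 : is_derive x 1 weight2 _ :=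
    is_deriveM d (@is_deriveV R (fun y => y ^+ 2) x _ _ x20 dx).
  by case: d2.
- rewrite /weight2 weight0 mul0r.
  apply: (@squeeze_cvgr _ _ _ _ (cst 0) (fun x => 6 / t ^+ 3 * x)).
  + near=> x.
    have x01 : 0 < x < 1.
      by apply/andP; split; near: x; [exact: nbhs_right_gt|exact: nbhs_right_lt].
    have /andP[x0 x1] := x01.
    rewrite weight2_ge0 (le_trans (weight2_le x01)) // ler_wpM2l //.
    by rewrite ler_piMr ?powR_le1 ?subr_ge0 ?gerBl // ltW.
  + exact: cvg_cst.
  + rewrite -[X in _ --> X](mulr0 (6 / t ^+ 3)); apply: cvgM; first exact: cvg_cst.
    by apply: cvg_at_right_filter; exact: cvg_id.
- rewrite [weight2 1]/weight2 /weight subrr powR0 ?gt_eqF // mulr0 mul0r.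
  apply: (@squeeze_cvgr _ _ _ _ (cst 0) (fun x => 6 / t ^+ 3 * (1 - x) `^ beta)).
  + near=> x.
    have x01 : 0 < x < 1.
      by apply/andP; split; near: x; [exact: nbhs_left_gt|exact: nbhs_left_lt].
    have /andP[x0 x1] := x01.
    rewrite weight2_ge0 (le_trans (weight2_le x01)) // ler_wpM2l //.
    by rewrite ler_piMl ?powR_ge0 // ltW.
  + exact: cvg_cst.
  + rewrite -[X in _ --> X](mulr0 (6 / t ^+ 3)); apply: cvgM; first exact: cvg_cst.
    exact: powR_onem_cvg0.
Unshelve. all: end_near. Qed.

Lemma continuous_poly_weight2 (p : {poly R}) :
  {within `[0, 1], continuous (fun x => p.[x] * weight2 x)}.
Proof.
apply/subspace_continuousP => x x01; apply: cvgM.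
  by apply: cvg_within_filter; exact: continuous_horner.
by move/subspace_continuousP : continuous_weight2; exact.
Qed.

Lemma integrable_poly_weight2 (p : {poly R}) :
  mu.-integrable `[0, 1] (fun x => (p.[x] * weight2 x)%:E).
Proof.
apply: continuous_compact_integrable; first exact: segment_compact.
exact: continuous_poly_weight2.
Qed.

Definition weight2_int (p : {poly R}) : R :=
  (\int[mu]_(x in `[0, 1]) (p.[x] * weight2 x))%R.

Lemma weight2_int_linear : scalar weight2_int.
Proof.
move=> a p q; rewrite /weight2_int -RintegralZl //; last exact: integrable_poly_weight2.
have E : (fun x => a * (p.[x] * weight2 x)) = (fun x => (a *: p).[x] * weight2 x).
  by apply/funext => x; rewrite hornerZ mulrA.
rewrite E -RintegralD //; [|exact: integrable_poly_weight2..].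
by apply: eq_Rintegral => x _; rewrite hornerD mulrDl.
Qed.
HB.instance Definition _ :=
  GRing.isLinear.Build R {poly R} R _ weight2_int weight2_int_linear.

Definition weight2_functional : {scalar {poly R}} := weight2_int.

Lemma weight2_gt0 (x : R) : 0 < x < 1 -> 0 < weight2 x.
Proof.
move=> x01; rewrite divr_gt0 ?weight_gt0 ?exprn_gt0 //.
by case/andP: x01.
Qed.

(** If the integral vanished, the integrand would be zero almost everywhere. It is nonzero on the
    open interval off the finitely many roots of [p], so that interval would have measure 0. *)
Lemma weight2_int_gt0 (p : {poly R}) : p != 0 ->
  (forall x, 0 <= x <= 1 -> 0 <= p.[x]) -> 0 < weight2_int p.
Proof.
move=> p0 p_ge0.
have f_ge0 x : `[0, 1]%classic x -> 0 <= p.[x] * weight2 x.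
  by rewrite /= in_itv /= => x01; rewrite mulr_ge0 ?p_ge0 ?weight2_ge0.
rewrite lt_neqAle (Rintegral_ge0 mu f_ge0) andbT eq_sym; apply/negP => /eqP I0.
have mD : measurable (`[0, 1]%classic : set R) by [].
have /integrableP[mf _] := integrable_poly_weight2 p.
have : (\int[mu]_(x in `[0%R, 1%R]) `|(p.[x] * weight2 x)%:E|)%E = 0%E.
  transitivity (\int[mu]_(x in `[0%R, 1%R]) (p.[x] * weight2 x)%:E)%E.
    by apply: eq_integral => x; rewrite inE => x01; rewrite gee0_abs ?lee_fin ?f_ge0.
  rewrite -[LHS]fineK; first by congr (_%:E); exact: I0.
  by apply: integrable_fin_num => //; exact: integrable_poly_weight2.
move/(ae_eq_integral_abs mu mD mf) => [N [mN N0 sN]].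
have rts0 : mu [set x | root p x] = 0%E.
  by apply/countable_lebesgue_measure0/finite_set_countable/finite_roots.
have mr : measurable [set x | root p x].
  apply: countable_measurable => [x|]; first exact: measurable_set1.
  exact/finite_set_countable/finite_roots.
have : (mu `]0%R, 1%R[ <= mu (N `|` [set x | root p x]))%E.
  apply: le_measure; rewrite ?inE //; first exact: measurableU.
  move=> x /=; rewrite in_itv /= => x01.
  have [rx|rx] := boolP (root p x); [by right|left].
  apply: sN => /= H; move: rx.
  have x01' : `[0, 1]%classic x by case/andP: x01 => ? ?; rewrite /= in_itv /= !ltW.
  have := H x01' => -[] /eqP.
  by rewrite mulf_eq0 (gt_eqF (weight2_gt0 x01)) orbF /root => ->.
rewrite lebesgue_measure_itv /= lte01 sube0 => le1.
have : (1 <= 0 :> \bar R)%E.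
  by apply: (le_trans le1); rewrite -[leRHS]adde0 -{1}N0 -rts0; exact: measureU2.
by rewrite lee_fin ler10.
Qed.

(** The fundamental theorem of calculus for g w with g = (1 - X) p, which vanishes at both
    endpoints. The factor 1 - X cancels the pole at 1 of the logarithmic derivative of w. *)
Lemma weight2_int_ibp (p : {poly R}) :
  weight2_int ('X^2 * ((1 - 'X) * p)^`() + (alpha *: 'X + t%:P) * ((1 - 'X) * p))
  = beta * weight2_int ('X^2 * p).
Proof.
set g := (1 - 'X) * p.
have gx (x : R) : g.[x] = (1 - x) * p.[x].
  by rewrite /g hornerM hornerD hornerN hornerX -polyC1 hornerC.
clearbody g.
pose q := 'X^2 * g^`() + (alpha *: 'X + t%:P) * g - beta *: ('X^2 * p).
apply/eqP; rewrite -subr_eq0; apply/eqP.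
have -> : weight2_int ('X^2 * g^`() + (alpha *: 'X + t%:P) * g) 
    - beta * weight2_int ('X^2 * p) = weight2_int q.
  by rewrite addrC -mulNr -weight2_int_linear scaleNr addrC.
have XE (f : {poly R}) (x : R) : ('X^2 * f).[x] = x ^+ 2 * f.[x].
  by rewrite hornerM hornerXn.
(* Reduces continuity of g w at the endpoints to [continuous_poly_weight2]. *)
have gE (x : R) : g.[x] * w x = ('X^2 * g).[x] * weight2 x.
  have [->|x0] := eqVneq x 0; last by rewrite XE /weight2; field.
  by rewrite weight0 // XE expr0n /= !(mul0r, mulr0).
have cg := @continuous_poly_weight2 ('X^2 * g).
have [_ c0 c1] := (continuous_within_itvP _ ltr01).1 cg.
have dF (x : R) : 0 < x < 1 ->
    is_derive x 1 (fun y => g.[y] * w y) (q.[x] * weight2 x).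
  move=> x01; have dw := is_derive_weight x01.
  have d : is_derive x 1 (fun y => g.[y] * w y) _ :=
    is_deriveM (is_derive_poly g x) dw.
  apply: is_derive_eq d _; rewrite /GRing.scale /=.
  rewrite /q hornerD hornerN hornerZ hornerD !XE hornerM hornerD hornerZ.
  rewrite hornerX hornerC /weight2 gx.
  by case/andP: x01 => x0 x1; field; rewrite !gt_eqF // subr_gt0.
rewrite /weight2_int /Rintegral (@continuous_FTC2 _ _ (fun y => g.[y] * w y)) //.
- by rewrite weight0 // mulr0 gx subrr !mul0r sube0.
- exact: continuous_poly_weight2.
- split.
  + by move=> x; rewrite in_itv /= => /dF[].
  + by rewrite gE; under eq_fun do rewrite gE.
  + by rewrite gE; under eq_fun do rewrite gE.
- by move=> x; rewrite in_itv /= => /dF d; rewrite derive1E; case: d.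
Qed.

Lemma momentE k : moment alpha beta t k = weight2_int ('X^2 * 'X^k).
Proof.
apply: eq_Rintegral => x _; rewrite hornerM !hornerXn /weight2.
have [->|x0] := eqVneq x 0; first by rewrite weight0 expr0n /= !(mulr0, mul0r).
by field.
Qed.

End Weight.

(** * Differentiation of the moments in the parameter t *)

Section MomentDerivative.
Context (R : realType) (alpha beta t : R).
Hypotheses (alpha_gt0 : 0 < alpha) (beta_gt0 : 0 < beta) (t_gt0 : 0 < t).
Local Notation mu := (@lebesgue_measure R).

Lemma is_derive_weight_param (s x : R) :
  is_derive s 1 (fun u => weight alpha beta u x) (- (weight alpha beta s x / x)).
Proof.
have dl : is_derive s 1 (fun u : R => - (u / x)) (- x^-1).
  have d := is_deriveZ (- x^-1) (is_derive_id s (1 : R)).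
  have -> : (fun u : R => - (u / x)) = (- x^-1) \*: id.
    by apply/funext => u /=; rewrite /GRing.scale /= mulNr mulrC.
  by apply: is_derive_eq d _; rewrite /GRing.scale /= mulr1.
have dE := @is_derive1_comp R expR (fun u : R => - (u / x)) s _ _ (is_derive_expR _) dl.
have d := is_deriveZ (x `^ alpha * (1 - x) `^ beta) dE.
have -> : (fun u => weight alpha beta u x)
  = (x `^ alpha * (1 - x) `^ beta) \*: (expR \o (fun u : R => - (u / x))).
  by apply/funext => u /=; rewrite /GRing.scale /= /weight -mulrA mulrC.
by apply: is_derive_eq d _; rewrite /GRing.scale /= /weight; ring.
Qed.

Lemma weight_le (s u x : R) : 0 <= x -> s <= u ->
  weight alpha beta u x <= weight alpha beta s x.
Proof.
move=> x0 su; rewrite /weight !ler_wpM2r ?powR_ge0 // ler_expR lerN2.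
by rewrite ler_wpM2r ?invr_ge0.
Qed.

Lemma is_derive_moment k : is_derive t 1 (fun s => moment alpha beta s k)
  (- weight2_int alpha beta t 'X^(k.+1)).
Proof.
pose f (s x : R) := x ^+ k * weight alpha beta s x.
have df (s x : R) : is_derive s 1 (f ^~ x) (- (x ^+ k * weight alpha beta s x / x)).
  have := is_deriveZ (x ^+ k) (is_derive_weight_param s x).
  by move=> d; apply: is_derive_eq d _; rewrite /GRing.scale /=; ring.
have d1f (s x : R) : partial1of2 f s x = - (x ^+ k * weight alpha beta s x / x).
  by rewrite partial1of2E; case: (df s x).
have w2E (s x : R) : x * weight alpha beta s x / x ^+ 2 = weight alpha beta s x / x.
  by have [->|x0] := eqVneq x 0; [rewrite !(mul0r, invr0, mulr0) | field].
have t2 : 0 < t / 2 by rewrite divr_gt0.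
have It : (`]t / 2, t + 1[%classic : set R) t.
  by rewrite /= in_itv /= ltrDl ltr01 andbT gtr_pMr // invf_lt1 // ltr1n.
have mD : measurable (`[0, 1]%classic : set R) by [].
have intf s : (`]t / 2, t + 1[%classic : set R) s ->
    mu.-integrable `[0, 1] (EFin \o f s).
  rewrite /= in_itv /= => /andP[ts _]; have s0 : 0 < s := lt_trans t2 ts.
  have := integrable_poly_weight2 alpha_gt0 beta_gt0 s0 ('X^2 * 'X^k).
  apply: eq_integrable => // x _; rewrite /f /weight2 hornerM !hornerXn.
  congr (_%:E); have [->|x0] := eqVneq x 0; last by field.
  by rewrite weight0 // !(mul0r, mulr0).
have derf s x : (`]t / 2, t + 1[%classic : set R) s -> `[0, 1]%classic x ->
    derivable (f ^~ x) s 1.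
  by move=> _ _; case: (df s x).
(* The dominating function: w decreases in its parameter, so for s > t/2 and 0 < x <= 1, x^k w_s / x
   <= w_(t/2) / x <= w_(t/2) / x^2. *)
pose G := weight2 alpha beta (t / 2).
have G0 x : 0 <= G x by exact: weight2_ge0.
have intG : mu.-integrable `[0, 1] (EFin \o G).
  have := integrable_poly_weight2 alpha_gt0 beta_gt0 t2 1.
  by apply: eq_integrable => // x _; rewrite -polyC1 hornerC mul1r.
have Gub s x : (`]t / 2, t + 1[%classic : set R) s -> `[0, 1]%classic x ->
    `|partial1of2 f s x| <= G x.
  rewrite /= !in_itv /= => /andP[ts _] /andP[x0 x1].
  have w0 := weight_ge0 alpha beta.
  rewrite d1f normrN ger0_norm; last by rewrite divr_ge0 // mulr_ge0 // exprn_ge0.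
  have [->|xn0] := eqVneq x 0; first by rewrite invr0 mulr0 G0.
  have xp : 0 < x by rewrite lt_neqAle eq_sym xn0.
  rewrite /G /weight2 ler_pdivrMr // -mulrA.
  have -> : (x ^+ 2)^-1 * x = x^-1 by field.
  apply: (@le_trans _ _ (weight alpha beta s x)).
    by rewrite ler_piMl // exprn_ile1.
  apply: (le_trans (weight_le x0 (ltW ts))).
  by rewrite ler_peMr // -[leLHS]invr1 lef_pV2 ?posrE.
have dv := @derivable_under_integral R _ _ mu f `[0, 1] mD t _ _ It
  intf derf G G0 intG Gub.
have de := @differentiation_under_integral R _ _ mu f `[0, 1] mD t _ _ It
  intf derf G G0 intG Gub.
apply: DeriveDef => //; rewrite -derive1E de /weight2_int.
rewrite -mulN1r -RintegralZl //; last first.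
  exact: (integrable_poly_weight2 alpha_gt0 beta_gt0 t_gt0).
apply: eq_Rintegral => x _; rewrite d1f hornerXn exprS mulN1r; congr (- _).
by rewrite -mulrA -w2E /weight2; ring.
Qed.

End MomentDerivative.

(** * The Hankel determinant *)

Section DetDerivative.
Context (R : realType).
Implicit Types (t : R).

Lemma is_derive_bigsum (I : Type) (r : seq I) (f : I -> R -> R) (df : I -> R) t :
  (forall i, is_derive t 1 (f i) (df i)) ->
  is_derive t 1 (fun s => \sum_(i <- r) f i s) (\sum_(i <- r) df i).
Proof.
move=> d; elim: r => [|i r IH].
  rewrite big_nil; under eq_fun do rewrite big_nil; exact: is_derive_cst.
rewrite big_cons; under eq_fun do rewrite big_cons; exact: is_deriveD.
Qed.

Lemma derivable_bigprod (I : Type) (r : seq I) (P : pred I) (f : I -> R -> R) t :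
  (forall i, derivable (f i) t 1) ->
  derivable (fun s => \prod_(i <- r | P i) f i s) t 1.
Proof.
move=> d; elim: r => [|i r IH].
  by under eq_fun do rewrite big_nil; exact: derivable_cst.
case Pi : (P i); last by under eq_fun do rewrite big_cons Pi.
have -> : (fun s => \prod_(j <- i :: r | P j) f j s)
    = f i * (fun s => \prod_(j <- r | P j) f j s).
  by apply/funext => s; rewrite big_cons Pi.
exact: (derivableM (d i) IH).
Qed.

Lemma is_derive_bigprod_log (I : Type) (r : seq I) (f : I -> R -> R) (df : I -> R) t :
  (forall i, is_derive t 1 (f i) (df i)) -> (forall i, f i t != 0) ->
  is_derive t 1 (fun s => \prod_(i <- r) f i s)
    ((\prod_(i <- r) f i t) * \sum_(i <- r) df i / f i t).
Proof.
move=> d n0; elim: r => [|i r IH].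
  rewrite !big_nil mulr0; under eq_fun do rewrite big_nil; exact: is_derive_cst.
rewrite !big_cons; under eq_fun do rewrite big_cons.
have d' : is_derive t 1 (fun s => f i s * \prod_(j <- r) f j s) _ :=
  is_deriveM (d i) IH.
by apply: is_derive_eq d' _; rewrite /GRing.scale /=; field.
Qed.

Lemma is_derive_mul_zeros (f g : R -> R) t :
  derivable f t 1 -> derivable g t 1 -> f t = 0 -> g t = 0 ->
  is_derive t 1 (f * g) 0.
Proof.
move=> /derivableP df /derivableP dg f0 g0.
apply: is_derive_eq (is_deriveM df dg) _.
by rewrite f0 g0 /GRing.scale /= !mul0r addr0.
Qed.

Lemma det_diagonal n (A : 'M[R]_n) : (forall i j, i != j -> A i j = 0) ->
  \det A = \prod_i A i i.
Proof.
move=> off; have E : A = diag_mx (\row_i A i i).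
  apply/matrixP => i j; rewrite !mxE.
  by have [->|/off ->] := eqVneq i j; rewrite ?mulr1n ?mulr0n.
by rewrite [in LHS]E det_diag; apply: eq_bigr => i _; rewrite mxE.
Qed.

(* A permutation other than the identity moves at least two indices, so its
   term in the determinant vanishes to second order. *)
Lemma is_derive_det_diag n (M : R -> 'M[R]_n) (dM : 'I_n -> 'I_n -> R) t :
  (forall i j, is_derive t 1 (fun s => M s i j) (dM i j)) ->
  (forall i j, i != j -> M t i j = 0) -> (forall i, M t i i != 0) ->
  is_derive t 1 (fun s => \det (M s))
    (\det (M t) * \sum_(i < n) dM i i / M t i i).
Proof.
move=> d off diag.
rewrite det_diagonal //.
have -> : \prod_i M t i i * (\sum_i dM i i / M t i i)
  = \sum_(s : {perm 'I_n})
      (if s == 1%g then \prod_i M t i i * (\sum_i dM i i / M t i i) else 0).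
  by rewrite -big_mkcond big_pred1_eq.
rewrite /determinant; apply: is_derive_bigsum => s.
have [->|s1] := eqVneq s 1%g.
  under eq_fun do (rewrite odd_perm1 mul1r; under eq_bigr do rewrite perm1).
  by apply: (@is_derive_bigprod_log _ _ (fun i u => M u i i)).
have [i si] : exists i, s i != i.
  apply/existsP; apply: contraNT s1; rewrite negb_exists => /forallP H.
  by apply/eqP/permP => i; rewrite perm1; apply/eqP; rewrite -[_ == _]negbK.
have sj : s (s i) != s i by rewrite (inj_eq perm_inj).
pose rest u := (-1) ^+ s * \prod_(k | (k != i) && (k != s i)) M u k (s k).
have -> : (fun u => (-1) ^+ s * \prod_k M u k (s k))
    = (fun u => M u i (s i)) * ((fun u => M u (s i) (s (s i))) * rest).
  apply/funext => u; rewrite (bigD1 i) //= (bigD1 (s i)) //=.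
  have mulCA4 (a b c e : R) : a * (b * (c * e)) = b * (c * (a * e)) by ring.
  exact: mulCA4.
have dx k : derivable (fun u => M u k (s k)) t 1 by case: (d k (s k)).
have z k : s k != k -> M t k (s k) = 0 by move=> sk; rewrite off // eq_sym.
have drest : derivable rest t 1.
  by apply: derivableM; [exact: derivable_cst|exact: derivable_bigprod].
apply: (is_derive_mul_zeros (dx i) (derivableM (dx (s i)) drest)); first exact: z.
by rewrite mulrfctE z // mul0r.
Qed.

End DetDerivative.

(** Change of basis from monomials to the P_i. The functional is arbitrary because the lemma serves
    twice: with [K2] for the Gram matrix and with [K1] for its derivative. *)
Lemma gram_mxE (R : comNzRingType) (L : {scalar {poly R}}) n (P : nat -> {poly R})
    (U := \matrix_(i < n, j < n) (P i)`_j) (i j : 'I_n) :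
  (forall k, (size (P k) <= k.+1)%N) ->
  (U *m (\matrix_(k, l) L 'X^(k + l)) *m U^T) i j = L (P i * P j).
Proof.
move=> sP.
have PE (k : 'I_n) : P k = \sum_(l < n) U k l *: 'X^l.
  have -> : P k = \poly_(l < n) (P k)`_l.
    apply/polyP => l; rewrite coef_poly; case: ltnP => // nl.
    by rewrite nth_default // (leq_trans (sP k)) // (leq_trans (ltn_ord k)).
  by rewrite poly_def; apply: eq_bigr => l _; rewrite mxE.
rewrite (PE i) (PE j) mulr_sumr linear_sum /= mxE; apply: eq_bigr => l _.
rewrite -scalerAr linearZ /= mulr_suml linear_sum /= !mxE mulrC; congr (_ * _).
apply: eq_bigr => k _; rewrite !mxE -scalerAl linearZ /=.
by rewrite -exprD.
Qed.

Section Hankel.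
Context (R : realType) (alpha beta t : R).
Hypotheses (alpha_gt0 : 0 < alpha) (beta_gt0 : 0 < beta) (t_gt0 : 0 < t).
Let K := weight2_functional alpha_gt0 beta_gt0 t_gt0.

Lemma weight2_functional_gt0 (p : {poly R}) : p != 0 ->
  (forall x, 0 <= x <= 1 -> 0 <= p.[x]) -> 0 < K p.
Proof. exact: weight2_int_gt0. Qed.

Lemma weight2_functional_ibp (p : {poly R}) :
  dK alpha t K ((1 - 'X) * p) = beta * K2 K p.
Proof. exact: weight2_int_ibp. Qed.

Let K2_gt0 := K2_gt0 weight2_functional_gt0.
Local Notation P := (orthopoly (K2 K)).
Local Notation h := (sqnorm (K2 K)).

Section HankelSize.
Context (n : nat).
(** The basis is frozen at the given t and only the moments vary with s. The determinant of the
    product is thus the Hankel determinant for every s, while the product is known to be diagonal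
    only at s = t. *)
Let U := \matrix_(i < n, j < n) (P i)`_j.
Let M s := \matrix_(i < n, j < n) moment alpha beta s (i + j).

Let sP k : (size (P k) <= k.+1)%N. Proof. by rewrite size_orthopoly. Qed.

Let detU : \det U = 1.
Proof.
rewrite det_trig; first by apply: big1 => i _; rewrite mxE orthopoly_lead.
apply/is_trig_mxP => i j ij; rewrite mxE nth_default //.
by rewrite size_orthopoly.
Qed.

Let detM s : \det (U *m M s *m U^T) = hankel alpha beta n s.
Proof. by rewrite !det_mulmx det_tr detU mulr1 mul1r. Qed.

Let gram i j : (U *m M t *m U^T) i j = K2 K (P i * P j).
Proof.
rewrite -(gram_mxE (K2 K)) //; congr ((_ *m _ *m _) i j).
by apply/matrixP => k l; rewrite !mxE momentE.
Qed.

Let gram_offdiag i j : i != j -> (U *m M t *m U^T) i j = 0.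
Proof.
rewrite gram neq_ltn => /orP[] ij; first exact: orthopoly_orthogonal K2_gt0 _ _ ij.
by rewrite mulrC (orthopoly_orthogonal K2_gt0).
Qed.

Let gram_diag i : (U *m M t *m U^T) i i = h i.
Proof. by rewrite gram -expr2. Qed.

Lemma hankel_gt0 : 0 < hankel alpha beta n t.
Proof.
rewrite -detM det_diagonal; last exact: gram_offdiag.
by apply: prodr_gt0 => i _; rewrite gram_diag sqnorm_gt0.
Qed.

Lemma is_derive_gram i j :
  is_derive t 1 (fun s => (U *m M s *m U^T) i j) (- K1 K (P i * P j)).
Proof.
rewrite -(gram_mxE (K1 K)) //.
have -> : (fun s => (U *m M s *m U^T) i j)
    = (fun s => \sum_(l < n) U j l * \sum_(k < n) U i k * moment alpha beta s (k + l)).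
  apply/funext => s; rewrite mxE; apply: eq_bigr => l _.
  by rewrite !mxE mulrC; congr (_ * _); apply: eq_bigr => k _; rewrite !mxE.
have -> : - (U *m (\matrix_(k, l) K1 K 'X^(k + l)) *m U^T) i j
    = \sum_(l < n) U j l * \sum_(k < n) U i k * - K 'X^((k + l).+1).
  rewrite mxE -sumrN; apply: eq_bigr => l _.
  rewrite !mxE -mulNr mulrC; congr (_ * _).
  rewrite -sumrN; apply: eq_bigr => k _; rewrite !mxE mulrN.
  by rewrite /K1 exprS.
apply: is_derive_bigsum => l; apply: is_deriveZ.
apply: is_derive_bigsum => k; apply: is_deriveZ.
exact: is_derive_moment.
Qed.

Lemma Hn_acoef : Hn alpha beta t n = - \sum_(j < n) acoef t K j.
Proof.
have d : is_derive t 1 (fun s => hankel alpha beta n s)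
    (hankel alpha beta n t * \sum_(i < n) - K1 K (P i * P i) / h i).
  have nz i : (U *m M t *m U^T) i i != 0 by rewrite gram_diag gt_eqF ?sqnorm_gt0.
  have := is_derive_det_diag is_derive_gram gram_offdiag nz.
  have E : (fun s => \det (U *m M s *m U^T)) = hankel alpha beta n.
    by apply/funext => s; exact: detM.
  rewrite E (detM t).
  by under eq_bigr do rewrite gram_diag.
have dl := @is_derive1_comp R (@ln R) (hankel alpha beta n) t _ _
  (is_derive1_ln hankel_gt0) d.
have {dl} [_ dl] : is_derive t 1 (fun s => ln (hankel alpha beta n s)) _ := dl.
rewrite /Hn derive1E dl.
rewrite mulKf ?gt_eqF ?hankel_gt0 // mulr_sumr -sumrN.
by apply: eq_bigr => i _; rewrite /acoef expr2 mulNr mulrN mulrA.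
Qed.

End HankelSize.
End Hankel.

(** * The difference equation *)

Section Main.
Context (R : realType) (alpha beta t : R).
Hypotheses (alpha_gt0 : 0 < alpha) (beta_gt0 : 0 < beta) (t_gt0 : 0 < t).
Let K := weight2_functional alpha_gt0 beta_gt0 t_gt0.
Let Kgt0 := weight2_functional_gt0 alpha_gt0 beta_gt0 t_gt0.
Let Kibp := weight2_functional_ibp alpha_gt0 beta_gt0 t_gt0.
Local Notation Ht := (Htilde alpha beta t).
Local Notation hs := (Hshift alpha beta t).
Local Notation a := (acoef t K).
Local Notation c := (ccoef alpha t K).
Local Notation p1 := (subcoef (K2 K)).

Lemma Htilde_step n : Ht n - Ht n.+1 = c n.
Proof.
rewrite (ccoefE Kgt0 Kibp) /Htilde !(Hn_acoef alpha_gt0 beta_gt0 t_gt0).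
rewrite big_ord_recr /= -[n.+1%:R]natr1; set S := \sum_(_ < _) _; ring.
Qed.

Lemma Hshift_subcoef n : hs n = (2 * n%:R + alpha + beta) * p1 n.
Proof.
rewrite (kappa_subcoef Kgt0 Kibp) /Hshift /Htilde.
rewrite (Hn_acoef alpha_gt0 beta_gt0 t_gt0).
ring.
Qed.

Section Step.
Context (n : nat).
Local Notation N := (n.+1%:R : R).
Let kappa : R := 2 * N + alpha + beta.

Let kappa_gt0 : 0 < kappa.
Proof. by rewrite /kappa !addr_gt0 // mulr_gt0 // ltr0Sn. Qed.

Let kappa_neq0 : kappa != 0. Proof. by rewrite gt_eqF. Qed.

Let cS : c n.+1 = a n.+1 + kappa + 1.
Proof. rewrite (ccoefE Kgt0 Kibp) /kappa; ring. Qed.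

Let c0 : c n = a n + kappa - 1.
Proof. rewrite (ccoefE Kgt0 Kibp) /kappa -[N]natr1; ring. Qed.

Let hS : hs n.+1 = kappa * p1 n.+1.
Proof. exact: Hshift_subcoef. Qed.

Let Ht0 : Ht n = Ht n.+1 + c n.
Proof. by rewrite -Htilde_step addrC subrK. Qed.

Let Ht2 : Ht n.+2 = Ht n.+1 - c n.+1.
Proof. by rewrite -Htilde_step opprB addrC subrK. Qed.

Let HtS : Ht n.+1 = kappa * p1 n.+1 - N * (beta + t).
Proof. by rewrite -hS /Hshift addrK. Qed.

Lemma Zn_coef : Zn alpha beta t n.+1
  = kappa * (a n.+1 * a n - c n.+1 * c n)
    - (kappa ^+ 2 - 1) * (2 * p1 n.+1 - beta - t).
Proof.
rewrite /Zn -/kappa /= hS /Hshift Ht2 Ht0 HtS cS c0.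
have -> : n.+2%:R = N + 1 :> R by rewrite natr1.
have -> : n%:R = N - 1 :> R by rewrite -natr1 addrK.
(* Eliminating alpha keeps kappa, the only denominator, as an atom for [field]. *)
have -> : alpha = kappa - 2 * N - beta by rewrite /kappa; ring.
by field.
Qed.

(** As -p1 <= N, the bracket beta + t - 2 p1 - kappa is at most t - alpha < t; as both a's are at
    least t, the subtracted term is at least 2 kappa^2 t. Hence Z_n <= -(kappa^2 + 1) t. *)
Lemma Zn_lt0 : Zn alpha beta t n.+1 < 0.
Proof.
have aS := acoef_ge Kgt0 n.+1 (ltW t_gt0).
have a0 := acoef_ge Kgt0 n (ltW t_gt0).
have q_ge := subcoef_ge Kgt0 n.+1.
have N1 : 1 <= N by rewrite ler1n.
have k1 : 1 < kappa.
  by rewrite /kappa; move: (N) N1 alpha_gt0 beta_gt0 => M M1 A B; lra.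
have pq : - (2 * p1 n.+1) <= 2 * N by lra.
have -> : Zn alpha beta t n.+1 = (kappa ^+ 2 - 1) * (beta + t - 2 * p1 n.+1 - kappa)
  - kappa * ((kappa + 1) * a n + (kappa - 1) * a n.+1).
  rewrite Zn_coef cS c0; ring.
have k2 : 0 < kappa ^+ 2 - 1 by rewrite subr_gt0 exprn_egt1.
have le1 : (kappa ^+ 2 - 1) * (beta + t - 2 * p1 n.+1 - kappa)
    <= (kappa ^+ 2 - 1) * t.
  by apply: ler_wpM2l; [exact: ltW | rewrite /kappa; move: alpha_gt0 => A; lra].
have le2 : 2 * kappa * t <= (kappa + 1) * a n + (kappa - 1) * a n.+1.
  have -> : 2 * kappa * t = (kappa + 1) * t + (kappa - 1) * t by ring.
  by apply: lerD; apply: ler_wpM2l => //; lra.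
have le3 : kappa * (2 * kappa * t)
    <= kappa * ((kappa + 1) * a n + (kappa - 1) * a n.+1).
  by rewrite ler_pM2l.
have pos : 0 < kappa ^+ 2 * t by rewrite mulr_gt0 ?exprn_gt0.
have t0 := t_gt0.
have E : (kappa ^+ 2 - 1) * t - kappa * (2 * kappa * t)
    = - (kappa ^+ 2 * t) - t by ring.
lra.
Qed.

Let q := p1 n.+1.
Let r := rcoef t K n.
Let s := scoef alpha t K n.
Let b := bcoef K n.

Let rs : r = s + q.
Proof. by rewrite /q -(rcoef_sub_scoef Kgt0 Kibp) addrC subrK. Qed.

Let r_eq : r ^+ 2 - t * r = b * a n.+1 * a n.
Proof. exact: rcoef_quadratic Kgt0 n. Qed.

Let s_eq : s ^+ 2 + beta * s = b * (a n.+1 + kappa + 1) * (a n + kappa - 1).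
Proof. by rewrite -cS -c0; exact: (scoef_quadratic Kgt0 Kibp). Qed.

Let mixed_eq : 2 * r * (s - N) - t * (s - N) - alpha * r
  = b * (a n.+1 * (a n + kappa - 1) + (a n.+1 + kappa + 1) * a n).
Proof. by rewrite -cS -c0; exact: (mixed_quadratic alpha t Kgt0). Qed.

Lemma cubicE : cubic alpha beta t n.+1 = b * Zn alpha beta t n.+1.
Proof.
rewrite Zn_coef cS c0 (b_Z rs r_eq s_eq mixed_eq) /cubic -/kappa hS -/q.
by field.
Qed.

Lemma ZtildeE : Ztilde alpha beta t n.+1 = kappa * s.
Proof.
rewrite (kappa_s rs r_eq s_eq mixed_eq) /Ztilde -/kappa cubicE hS -/q.
have := Zn_lt0; set Z := Zn _ _ _ _ => Z0.
by field; rewrite kappa_neq0 lt_eqF.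
Qed.

Lemma sigma_step :
  N * t - (2 * N + alpha) * hs n.+1 / kappa
  + Ztilde alpha beta t n.+1 / kappa * (- 2 * N - alpha - t + 2 * hs n.+1 / kappa)
  + 2 * Ztilde alpha beta t n.+1 ^+ 2 / kappa ^+ 2
  = 1 / Zn alpha beta t n.+1
    * (- 2 * Ht n.+1 ^+ 2 + 2 * Ht n.+1 * (1 + Ht n.+2)
       + Ht n.+2 * (2 * N - 1 + alpha + beta)
       - Ht n * (2 * N + 1 + alpha + beta - 2 * Ht n.+1 + 2 * Ht n.+2))
    * cubic alpha beta t n.+1.
Proof.
have Z0 := Zn_lt0.
transitivity (N * t - (2 * N + alpha) * q
  + s * (- 2 * N - alpha - t + 2 * q) + 2 * s ^+ 2).
  by rewrite ZtildeE hS -/q; field.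
(* With both neighbours of [Ht n.+1] written through [c], the terms in [Ht n.+1] cancel and the
   bracket is a_(n+1) c_n + c_(n+1) a_n. *)
rewrite (mixed_eq_s rs mixed_eq) cubicE Ht0 Ht2 cS c0 -/kappa.
move: (Ht n.+1) (Zn _ _ _ _) Z0 => H Z Z0.
have -> : alpha = kappa - 2 * N - beta by rewrite /kappa; ring.
by field; rewrite lt_eqF.
Qed.

End Step.
End Main.

Theorem theorem6p4 (R : realType) (alpha beta t : R) (n : nat)
  (alpha_gt0 : 0 < alpha) (beta_gt0 : 0 < beta) (t_gt0 : 0 < t)
  (n_ge1 : (1 <= n)%N) :
  let N := n%:R : R in
  let c := 2 * N + alpha + beta in
  let H := Htilde alpha beta t in
  let h := Hshift alpha beta t n in
  let Z := Zn alpha beta t n in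
  let Zt := Ztilde alpha beta t n in
  N * t - (2 * N + alpha) * h / c
  + Zt / c * (- 2 * N - alpha - t + 2 * h / c)
  + 2 * Zt ^+ 2 / c ^+ 2
  = 1 / Z
    * (- 2 * H n ^+ 2 + 2 * H n * (1 + H n.+1)
       + H n.+1 * (2 * N - 1 + alpha + beta)
       - H n.-1 * (2 * N + 1 + alpha + beta - 2 * H n + 2 * H n.+1))
    * cubic alpha beta t n.
Proof. by case: n n_ge1 => [//|n] _; exact: sigma_step. Qed.
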